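(* Let $(E,B,p,\Gamma)$ be a compact graph bundle, let $F:E\to E$ and $f:B\to B$ be continuous with $p\circ F=f\circ p$, and assume $(B,f)$ is minimal. Let $M$ be a minimal set of $F$ with $p(M)=B$, and assume $M$ is nowhere dense in $E$. Then either (E1) there is a residual set $R\subseteq B$ such that $M_b$ is a Cantor set for every $b\in R$, or (E2) there are a positive integer $N$ and a residual set $R\subseteq B$ such that $M_b$ has exactly $N$ points for every $b\in R$.
   Context: A graph is a nonempty compact metric space that is a union of finitely many arcs pairwise disjoint or meeting only at end-points. A compact graph bundle $(E,B,p,\Gamma)$: $E,B$ compact metric spaces, $\Gamma$ a graph, $p:E\to B$ a continuous surjection such that every $b\in B$ has an open neighbourhood $U$ and a homeomorphism $h:p^{-1}(U)\to U\times\Gamma$ with $\mathrm{pr}_1\circ h=p$. For $M\subseteq E$, $M_b=M\cap p^{-1}(b)$. A continuous selfmap of a compact metric space is minimal if it has no proper nonempty closed invariant subset; a minimal set of $F$ is a nonempty closed $F$-invariant set on which $F$ is minimal. A set is residual if its complement is a countable union of nowhere dense sets. *)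

(* Defs.v *)
From HB Require Import structures.
From mathcomp Require Import all_boot all_order all_algebra.
From mathcomp Require Import all_classical all_reals all_analysis.
Set Implicit Arguments. Unset Strict Implicit. Unset Printing Implicit Defensive.
Import Order.TTheory GRing.Theory Num.Theory.
Import numFieldNormedType.Exports.
Local Open Scope classical_set_scope.
Local Open Scope ring_scope.

Definition unit_interval (R : realType) : set R := [set t : R | 0 <= t <= 1].
Arguments unit_interval R : clear implicits.

(* An arc in T: the image of a continuous injective map from [0,1]
   (a homeomorphism onto its image, since [0,1] is compact and T Hausdorff).
   We record the parametrisation g; the end-points are g 0 and g 1. *)
Definition arc_param (R : realType) (T : topologicalType) (g : R -> T) :=
  {within unit_interval R, continuous g} /\ {in unit_interval R &, injective g}.

Definition arc_image (R : realType) (T : topologicalType) (g : R -> T) : set T :=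
  g @` unit_interval R.

Definition arc_ends (R : realType) (T : topologicalType) (g : R -> T) : set T :=
  [set g 0; g 1].

Definition is_graph (R : realType) (G : metricType R) :=
  [set: G] !=set0 /\ compact [set: G] /\
  exists (n : nat) (g : 'I_n -> R -> G),
    (forall i, arc_param (g i)) /\
    (forall x : G, exists i, arc_image (g i) x) /\
    (forall i j, i <> j ->
       arc_image (g i) `&` arc_image (g j) `<=` arc_ends (g i) `&` arc_ends (g j)).

Definition graph_bundle (R : realType) (E B G : metricType R) (p : E -> B) :=
  compact [set: E] /\ compact [set: B] /\ is_graph G /\
  continuous p /\ (forall b, exists x, p x = b) /\
  forall b : B, exists U : set B, open U /\ U b /\
    exists (h : E -> B * G) (k : B * G -> E),
      {within p @^-1` U, continuous h} /\
      {within U `*` [set: G], continuous k} /\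
      (forall x, (p @^-1` U) x -> (U `*` [set: G]) (h x)) /\
      (forall y, (U `*` [set: G]) y -> (p @^-1` U) (k y)) /\
      (forall x, (p @^-1` U) x -> k (h x) = x) /\
      (forall y, (U `*` [set: G]) y -> h (k y) = y) /\
      (forall x, (p @^-1` U) x -> (h x).1 = p x).

Definition invariant (T : Type) (F : T -> T) (A : set T) := F @` A `<=` A.

Definition minimal_set (T : topologicalType) (F : T -> T) (M : set T) :=
  [/\ M !=set0, closed M, invariant F M &
      forall A, A `<=` M -> A !=set0 -> closed A -> invariant F A -> A = M].

Definition minimal_map (T : topologicalType) (F : T -> T) :=
  continuous F /\ minimal_set F [set: T].

Definition nowhere_dense_set (T : topologicalType) (A : set T) :=
  interior (closure A) = set0.

Definition residual (T : topologicalType) (A : set T) :=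
  exists N : nat -> set T, (forall n, nowhere_dense_set (N n)) /\
    ~` A `<=` \bigcup_n N n.

(* A Cantor set: a subset homeomorphic to the Cantor space (nat -> bool).
   A continuous injection from the compact Cantor space into a Hausdorff space
   is a homeomorphism onto its image. *)
Definition cantor_set (T : topologicalType) (A : set T) :=
  exists f : cantor_space -> T, continuous f /\ injective f /\ range f = A.

Definition fibre (E B : Type) (p : E -> B) (M : set E) (b : B) : set E :=
  M `&` p @^-1` [set b].

(* Main.v *)
Require Import Defs.
From HB Require Import structures.
From mathcomp Require Import all_boot all_order all_algebra.
From mathcomp Require Import all_classical all_reals all_analysis.
From mathcomp Require Import lra.
Local Open Scope classical_set_scope.
Local Open Scope ring_scope.
Set Implicit Arguments.
Unset Strict Implicit.
Unset Printing Implicit Defensive.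
Import Order.TTheory GRing.Theory Num.Theory.
Import numFieldNormedType.Exports.

(** Off a meager set of base points, M -> B is open at every point of the fibre,
and by a Kuratowski-Ulam argument M_b has empty interior in p^-1(b).  If the
fibres with an isolated point form a meager set, a generic fibre is a perfect
compact subset without interior of a graph; cutting the arcs at points outside
it shows that it is zero-dimensional, hence a Cantor set.

Otherwise some open V meets M and contains at most one point of each generic
fibre.  By minimality all points of M enter V within K steps.  A minimal f maps
meager sets to meager sets and is injective off a meager set of values, so
generically M_b = F^K(M_c) with f^K(c) = b; two points of M_c entering V at the
same time have the same image, and M_b has at most K+1 points.  Let N be the
largest generic cardinality: by lower semicontinuity it is a lower bound for
|M_c| on an open W, and since |M_b| >= |M_(f^k b)|, the forward orbit of b
entering W gives |M_b| = N. *)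

(** * Meager sets *)

Definition meager (T : topologicalType) (A : set T) :=
  exists N : nat -> set T,
    (forall n, nowhere_dense_set (N n)) /\ A `<=` \bigcup_n N n.

Lemma residual_setC (T : topologicalType) (A : set T) :
  meager A -> residual (~` A).
Proof. by rewrite /residual setCK. Qed.

Lemma meager_sub (T : topologicalType) (A B : set T) :
  A `<=` B -> meager B -> meager A.
Proof. by move=> AB [N [ndN BN]]; exists N; split=> //; apply: subset_trans BN. Qed.

Lemma nowhere_dense_meager (T : topologicalType) (A : set T) :
  nowhere_dense_set A -> meager A.
Proof. by move=> ndA; exists (fun=> A); split=> // x Ax; exists 0%N. Qed.

Lemma nowhere_dense0 (T : topologicalType) : nowhere_dense_set (@set0 T).
Proof. by rewrite /nowhere_dense_set closure0 interior0. Qed.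

Lemma meager_bigcup (T : topologicalType) (I : countType) (A : I -> set T) :
  (forall i, meager (A i)) -> meager (\bigcup_i A i).
Proof.
move=> /choice[N HN].
exists (fun n => if unpickle n is Some (i, m) then N i m else set0); split.
  move=> n; case: unpickle => [[i m]|]; last exact: nowhere_dense0.
  exact: (HN i).1.
move=> x [i _ /(HN i).2 [m _ Nx]].
by exists (pickle (i, m)) => //; rewrite pickleK.
Qed.

Lemma meagerU (T : topologicalType) (A B : set T) :
  meager A -> meager B -> meager (A `|` B).
Proof.
move=> mA mB; apply: (@meager_sub _ _ (\bigcup_(b : bool) if b then A else B)).
  by move=> x [Ax|Bx]; [exists true|exists false].
by apply: meager_bigcup => -[].
Qed.

Lemma nowhere_denseP (T : topologicalType) (A : set T) :
  nowhere_dense_set A <->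
  forall U, open U -> U !=set0 -> ~ U `<=` closure A.
Proof.
split=> [ndA U oU [x Ux] UA|h].
  have : (closure A)° x by rewrite /interior nbhsE; exists U.
  by rewrite ndA.
apply/eqP; rewrite -[_ == _]negbK; apply/negP => /set0P[x ix].
by apply: (h (closure A)°); [exact: open_interior|exists x|exact: interior_subset].
Qed.

Lemma closed_nowhere_denseP (T : topologicalType) (A : set T) : closed A ->
  nowhere_dense_set A <-> forall U, open U -> U !=set0 -> ~ U `<=` A.
Proof. by move=> /closure_id cA; rewrite nowhere_denseP -cA. Qed.

Lemma nowhere_dense_closed_setD_interior (T : topologicalType) (A : set T) :
  closed A -> nowhere_dense_set (A `\` A°).
Proof.
move=> cA; apply/closed_nowhere_denseP.
  by apply: closedI => //; apply: open_closedC; exact: open_interior.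
move=> U oU [x Ux] UA; have [_] := UA x Ux; apply.
by rewrite /interior nbhsE; exists U => // y /UA[].
Qed.

(** Without a common point, every [x] has a neighbourhood missed by all late [C n], and compactness
    makes a single [C n] empty. *)
Lemma nested_closed_nonempty (T : topologicalType) (C : nat -> set T) :
  compact [set: T] -> (forall n, closed (C n)) ->
  (forall n, C n.+1 `<=` C n) -> (forall n, C n !=set0) ->
  exists x, forall n, C n x.
Proof.
move=> cT cC decC C0; apply: contrapT => /forallNP h.
have mono m n : (m <= n)%N -> C n `<=` C m.
  elim: n => [|n IH]; first by rewrite leqn0 => /eqP->.
  rewrite leq_eqVlt => /orP[/eqP->//|/IH]; exact: subset_trans.
have [//|n _ hn] :=
    (compact_near_coveringP _).1 cT nat \oo (fun n x => ~ C n x) _ _.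
  move=> x _; have /existsNP[n Cx] := h x.
  exists (~` C n, [set m | (n <= m)%N]) => /=.
    by split; [exact: open_nbhs_nbhs (conj (closed_openC (cC n)) Cx)|exists n].
  by move=> [y m] /= [Cy nm] /(mono _ _ nm).
by have [x Cx] := C0 n; exact: (hn n (leqnn n) x I).
Qed.

(** Replaces the choice of a neighbourhood by the choice of an index, so that exceptional sets
    become countable unions; closed members have closed images under continuous maps between the
    compact spaces in play. *)
Lemma compact_closed_base (R : realType) (T : metricType R) :
  compact [set: T] -> exists C : nat -> set T,
    (forall n, closed (C n)) /\
    (forall (x : T) V, nbhs x V -> exists n, nbhs x (C n) /\ C n `<=` V).
Proof.
move=> cT; have [[x0 _]|T0] := pselect ([set: T] !=set0); last first.
  exists (fun=> set0); split=> [n|x]; first exact: closed0.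
  by case: T0; exists x.
pose T' := HB.pack_for (pseudoPMetricType R) T (isPointed.Build T x0).
have [B /countable_injP[e einj] [Bo Bb]] := @compact_second_countable R T' cT.
(* An index not attained by [e] gets the default [set0]. *)
exists (fun n => closure (xget set0 [set U | B U /\ e U = n])).
split=> [n|x V]; first exact: closed_closure.
move=> /uniform_regular[W /(Bb x)[U [BU Ux] UW] WV].
exists (e U); case: xgetP => [U' _ [BU' eU']|/(_ U)[]//].
rewrite (einj U' U) ?inE//; split; last exact/(subset_trans _ WV)/closureS.
by apply: filterS (@subset_closure _ U) _; exact: open_nbhs_nbhs (conj (Bo _ BU) Ux).
Qed.

(** * Minimal maps *)

Lemma hausdorff_separation (T : topologicalType) (x y : T) :
  hausdorff_space T -> x <> y ->
  exists U V, [/\ nbhs x U, nbhs y V & U `&` V = set0].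
Proof.
move=> hT xy; apply: contrapT => h; apply: xy; apply: hT => U V xU yV.
by apply: contrapT => /nonemptyPn UV0; apply: h; exists U, V.
Qed.

Lemma compact_closed_image (T U : topologicalType) (f : T -> U) (A : set T) :
  compact [set: T] -> hausdorff_space U -> continuous f -> closed A ->
  closed (f @` A).
Proof.
move=> cT hU cf cA; apply: compact_closed => //; apply: continuous_compact.
  exact: continuous_subspaceT.
by apply: subclosed_compact cT _.
Qed.

Lemma invariant_iter (T : Type) (F : T -> T) (A : set T) k x :
  Defs.invariant F A -> A x -> A (iter k F x).
Proof. by move=> iA Ax; elim: k => //= k IH; apply: iA; exists (iter k F x). Qed.

Lemma continuous_iter (T : topologicalType) (F : T -> T) k :
  continuous F -> continuous (iter k F).
Proof.
move=> cF; elim: k => [|k IH] x; first exact: cvg_id.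
exact: (continuous_comp (IH x) (cF _)).
Qed.

Lemma minimal_set_image (T : topologicalType) (F : T -> T) (M : set T) :
  compact [set: T] -> hausdorff_space T -> continuous F -> minimal_set F M ->
  F @` M = M.
Proof.
move=> cT hT cF [[x Mx] cM iM minM]; apply: minM => //.
- by exists (F x); exists x.
- exact: compact_closed_image.
- by move=> _ [y /iM My <-]; exists y.
Qed.

(** The closure of the forward orbit of [x] is a nonempty closed invariant subset of [M], hence all
    of [M]. *)
Lemma minimal_set_hits (T : topologicalType) (F : T -> T) (M V : set T) (x : T) :
  continuous F -> minimal_set F M -> open V -> M `&` V !=set0 -> M x ->
  exists k, V (iter k F x).
Proof.
move=> cF [_ cM iM minM] oV [y [My Vy]] Mx.
have orbM : closure [set z | exists k, z = iter k F x] = M.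
  apply: minM.
  - apply: (@subset_trans _ (closure M)).
      by apply: closureS => _ [k ->]; exact: invariant_iter.
    exact: cM.
  - by exists x; apply: subset_closure; exists 0%N.
  - exact: closed_closure.
  - move=> _ [z cz <-] U /cF/cz[_ [[k ->] Uk]].
    by exists (F (iter k F x)); split => //; exists k.+1.
move: My; rewrite -orbM => /(_ V) []; first exact: open_nbhs_nbhs.
by move=> _ [[k ->] Vk]; exists k.
Qed.

(** An entrance time of one point serves a whole neighbourhood, as [iter k F] is continuous and [V]
    is open; compactness of [M] then bounds these times. *)
Lemma minimal_set_hits_bounded (T : topologicalType) (F : T -> T) (M V : set T) :
  compact [set: T] -> continuous F -> minimal_set F M -> open V ->
  M `&` V !=set0 ->
  exists K, forall x, M x -> exists2 k, (k <= K)%N & V (iter k F x).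
Proof.
move=> cT cF minM oV MV.
have cM : compact M by apply: subclosed_compact cT _ => //; case: minM.
have [//|K _ hK] := (compact_near_coveringP _).1 cM nat \oo
   (fun n x => exists2 k, (k <= n)%N & V (iter k F x)) _ _.
  move=> x Mx; have [k Vk] := minimal_set_hits cF minM oV MV Mx.
  exists (iter k F @^-1` V, [set m | (k <= m)%N]) => /=.
    split; last by exists k.
    have ck : continuous (iter k F) by exact: continuous_iter.
    by apply: ck; exact: open_nbhs_nbhs.
  by move=> [y m] /= [Vy km]; exists k.
by exists K => x Mx; exact: (hK K (leqnn K) x Mx).
Qed.

Section minimal_map_theory.
Variables (B : topologicalType) (f : B -> B).
Hypotheses (cB : compact [set: B]) (hB : hausdorff_space B) (minf : minimal_map f).

Lemma minimal_map_surj b : exists c, f c = b.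
Proof.
have [cf mf] := minf.
have : (f @` [set: B]) b by rewrite (minimal_set_image cB hB cf mf).
by move=> [c _ fc]; exists c.
Qed.

(* A closed set mapped onto the whole space would contain arbitrarily long,
   hence by compactness infinite, forward orbits. *)
Lemma minimal_map_irreducible (A : set B) :
  closed A -> f @` A = [set: B] -> A = [set: B].
Proof.
have [cf [[b0 _] _ _ minB]] := minf => cA fA.
pose C n := [set x | forall i, (i <= n)%N -> A (iter i f x)].
have [x Cx] : exists x, forall n, C n x.
  apply: nested_closed_nonempty => // [n|n x Cx i le_in|n].
  - have -> : C n = \bigcap_(i in [set i | (i <= n)%N]) (iter i f @^-1` A) by [].
    by apply: closed_bigI => i _; apply: preimage_closed => // y _;
      exact: continuous_iter.
  - by apply: Cx; exact: leq_trans (leqnSn n).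
  - elim: n => [|n [y Cy]].
      have [y Ay _] : (f @` A) b0 by rewrite fA.
      by exists y => i; rewrite leqn0 => /eqP->.
    have [z Az fz] : (f @` A) y by rewrite fA.
    exists z => -[_|i]; first exact: Az.
    by rewrite iterSr fz; exact: Cy.
apply/seteqP; split=> // y _.
(* The points whose whole forward orbit stays in [A] form a closed invariant set containing [x], so
   minimality makes it all of [B]. *)
have: [set x | forall i, A (iter i f x)] y.
  rewrite (minB [set x | forall i, A (iter i f x)]) //.
  - by exists x => i; exact: (Cx i i).
  - have -> : [set x | forall i, A (iter i f x)] = \bigcap_i (iter i f @^-1` A).
      by apply/seteqP; split=> z h i => [_|]; exact: h.
    by apply: closed_bigI => i _; apply: preimage_closed => // z _;
      exact: continuous_iter.
  - by move=> _ [z hz <-] i /=; rewrite -iterSr; exact: (hz i.+1).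
by move/(_ 0%N).
Qed.

(** Together with the complement of the preimage of [U], the set [A] still maps onto [B];
    irreducibility makes this union everything. *)
Lemma preimage_sub_of_sub_image (A U : set B) :
  closed A -> open U -> U `<=` f @` A -> f @^-1` U `<=` A.
Proof.
have [cf _] := minf => cA oU UA.
have : ~` (f @^-1` U) `|` A = [set: B].
  apply: minimal_map_irreducible.
    apply: closedU => //; apply: open_closedC.
    by apply: open_comp => // x _; exact: cf.
  apply/seteqP; split=> // b _.
  have [Ub|nUb] := pselect (U b).
    by have [a Aa <-] := UA b Ub; exists a => //; right.
  have [c fc] := minimal_map_surj b.
  by exists c => //; left; rewrite /= fc.
by move=> h x Ux; have [|//] : (~` (f @^-1` U) `|` A) x by rewrite h.
Qed.

Lemma preimage_nonempty_open (U : set B) :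
  open U -> U !=set0 -> open (f @^-1` U) /\ f @^-1` U !=set0.
Proof.
have [cf _] := minf => oU [b Ub]; split.
  by apply: open_comp => // x _; exact: cf.
by have [c fc] := minimal_map_surj b; exists c; rewrite /= fc.
Qed.

(** If the image of a closed nowhere dense set contained a nonempty open [U], irreducibility would
    put the open preimage of [U] inside that set. *)
Lemma minimal_map_image_meager (A : set B) : meager A -> meager (f @` A).
Proof.
have [cf _] := minf => -[N [ndN AN]].
exists (fun n => f @` closure (N n)); split=> [n|_ [x /AN[n _ Nx] <-]]; last first.
  by exists n => //; exists x => //; exact: subset_closure.
apply/closed_nowhere_denseP.
  by apply: compact_closed_image => //; exact: closed_closure.
move=> U oU U0 /(preimage_sub_of_sub_image (@closed_closure _ _) oU).
have [ofU fU0] := preimage_nonempty_open oU U0.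
by move/nowhere_denseP : (ndN n) => /(_ _ ofU fU0).
Qed.

Lemma minimal_map_preimage_meager (A : set B) : meager A -> meager (f @^-1` A).
Proof.
have [cf _] := minf => -[N [ndN AN]].
exists (fun n => f @^-1` closure (N n)); split=> [n|x /AN[n _ Nx]]; last first.
  by exists n => //; exact: subset_closure.
apply/closed_nowhere_denseP.
  by apply: preimage_closed => [x _|]; [exact: cf|exact: closed_closure].
move=> U oU [x Ux] UN.
(* The complement of [U] is a proper closed set, so by irreducibility its image misses a nonempty
   open set. Points there have all their preimages in [U] and therefore lie in [closure (N n)]. *)
have cV : closed (f @` ~` U) by apply: compact_closed_image => //; exact: open_closedC.
move/nowhere_denseP: (ndN n) => /(_ (~` (f @` ~` U)) (closed_openC cV)); apply.
  apply: contrapT => /nonemptyPn/(congr1 setC); rewrite setCK setC0 => h.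
  by have : (~` U) x by rewrite (minimal_map_irreducible (open_closedC oU) h).
move=> b nb; have [c fc] := minimal_map_surj b.
rewrite -fc; apply: (UN c); apply: contrapT => nUc; apply: nb.
by exists c.
Qed.

Lemma minimal_map_iter_image_meager k (A : set B) :
  meager A -> meager (iter k f @` A).
Proof.
move=> mA; elim: k => [|k IH]; first by rewrite image_id.
have -> : iter k.+1 f @` A = f @` (iter k f @` A) by rewrite image_comp.
exact: minimal_map_image_meager.
Qed.

Lemma minimal_map_iter_preimage_meager k (A : set B) :
  meager A -> meager (iter k f @^-1` A).
Proof.
move=> mA; elim: k => [//|k IH].
rewrite (_ : iter k.+1 f @^-1` A = f @^-1` (iter k f @^-1` A)).
  exact: minimal_map_preimage_meager.
by apply/seteqP; split=> x; rewrite /preimage/= -iterSr.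
Qed.

End minimal_map_theory.

(** Distinct preimages lie in disjoint basic closed sets. The images of two such sets have no
    nonempty open set in common, since its preimage would lie in both. *)
Lemma meager_noninjective_fibres (R : realType) (B : metricType R) (f : B -> B) :
  compact [set: B] -> minimal_map f ->
  meager [set b | exists c d, [/\ f c = b, f d = b & c <> d]].
Proof.
move=> cB minf; have hB := @metric_hausdorff R B; have [cf _] := minf.
have [C [cC baseC]] := compact_closed_base cB.
pose D (ij : nat * nat) := if pselect (C ij.1 `&` C ij.2 = set0) then
   f @` C ij.1 `&` f @` C ij.2 else set0.
apply: (@meager_sub _ _ (\bigcup_ij D ij)).
  move=> b [c [d [fc fd cd]]].
  have [U [V [cU dV UV]]] := hausdorff_separation hB cd.
  have [i [ci CU]] := baseC c U cU.
  have [j [dj CV]] := baseC d V dV.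
  exists (i, j) => //; rewrite /D; case: pselect => /=.
    by split; [exists c => //|exists d => //]; exact: nbhs_singleton.
  case; apply/seteqP; split=> // z [/CU Uz /CV Vz].
  by have : (U `&` V) z by []; rewrite UV.
apply: meager_bigcup => -[i j]; apply: nowhere_dense_meager.
rewrite /D; case: pselect => /= [Cij|nCij]; last exact: nowhere_dense0.
apply/closed_nowhere_denseP.
  by apply: closedI; exact: compact_closed_image.
move=> U oU U0; rewrite subsetI => -[Ui Uj].
have {}Ui := preimage_sub_of_sub_image cB hB minf (cC i) oU Ui.
have {}Uj := preimage_sub_of_sub_image cB hB minf (cC j) oU Uj.
have [_ [x fUx]] := preimage_nonempty_open cB hB minf oU U0.
have : (C i `&` C j) x by split; [exact: Ui|exact: Uj].
by rewrite Cij.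
Qed.

(** * Cantor sets *)

Lemma cantor_set_image (T U : topologicalType) (k : T -> U) (K : set T) :
  continuous k -> injective k -> cantor_set K -> cantor_set (k @` K).
Proof.
move=> ck ik [f [cf [injf <-]]]; exists (k \o f); split; [|split].
- by move=> x; apply: continuous_comp; [exact: cf|exact: ck].
- exact: inj_comp.
- by rewrite image_comp.
Qed.

Lemma compact_set_type (T : topologicalType) (A : set T) :
  compact A -> compact [set: set_type A].
Proof.
move=> cA F PF _.
have [a [Aa cla]] : A `&` cluster (set_val @ F) !=set0.
  apply: cA; change (F (set_val @^-1` A)).
  rewrite (_ : _ @^-1` _ = setT); first exact: filterT.
  by apply/seteqP; split=> x // _; exact: set_valP.
exists (exist _ a (mem_set Aa)); split=> // P Q FP [W [[V oV <-] Va] VQ].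
have [_ [[x Px <-] Vx]] : (set_val @` P) `&` V !=set0.
  apply: cla; last by apply: open_nbhs_nbhs; split.
  change (F (set_val @^-1` (set_val @` P))).
  by apply: filterS FP => x Px; exists x.
by exists x; split=> //; exact: VQ.
Qed.

(** Brouwer's characterisation of the Cantor space, applied to [A] as a space of its own: the traces
    of [P] and [Q] on [A] are complementary closed sets, hence clopen. *)
Lemma zero_dimensional_perfect_cantor (R : realType) (T : metricType R)
    (A : set T) :
  A !=set0 -> compact A -> A `<=` limit_point A ->
  (forall x y, A x -> A y -> x <> y -> exists P Q : set T,
    [/\ closed P, closed Q, A `<=` P `|` Q, A `&` (P `&` Q) = set0 & P x /\ Q y]) ->
  cantor_set A.
Proof.
move=> [a Aa] cA limA sepA; have hT := @metric_hausdorff R T.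
have cval : continuous (@set_val T A) by exact: initial_continuous.
pose S := HB.pack_for (pseudoPMetricType R) (set_type A)
  (isPointed.Build (set_type A) (exist _ a (mem_set Aa))).
have cantorS : cantor_like S.
  split.
  - apply/perfectTP => x [W oW Wx].
    have [|y [/eqP yx Ay Wy]] := limA (set_val x) (set_valP x) W.
      by apply: open_nbhs_nbhs; split=> //; have : [set x] x by []; rewrite -Wx.
    have : [set x] (exist _ y (mem_set Ay) : S) by rewrite -Wx.
    by move=> /(congr1 set_val) /= yx'; apply: yx; rewrite -yx'.
  - exact: compact_set_type.
  - move=> x y xy; apply: val_inj; apply: hT => U V xU yV.
    by have [z [Uz Vz]] := xy _ _ (cval x _ xU) (cval y _ yV); exists (set_val z).
  - move=> x y /eqP xy.
    have [|P [Q [cP cQ APQ PQ0 [Px Qy]]]] := sepA _ _ (set_valP x) (set_valP y).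
      by move=> /val_inj.
    have PQ (z : S) : P (set_val z) <-> ~ Q (set_val z).
      split=> [Pz Qz|nQz]; last by have [] := APQ _ (set_valP z).
      have : (A `&` (P `&` Q)) (set_val z) by split=> //; exact: set_valP.
      by rewrite PQ0.
    exists (set_val @^-1` P); split=> //; last by move=> /PQ.
    split; last by apply: preimage_closed => // z _; exact: cval.
    rewrite -[X in open X]setCK; apply: closed_openC.
    rewrite (_ : ~` _ = set_val @^-1` Q).
      by apply: preimage_closed => // z _; exact: cval.
    apply/seteqP; split=> z /=; rewrite PQ; first by move/contrapT.
    by move=> Qz; apply.
have [f [cf _]] := homeomorphism_cantor_like cantorS.
exists (set_val \o f); split; [|split].
- by move=> x; apply: continuous_comp; [exact: cf|exact: cval].
- by move=> x y /val_inj; apply: inj; rewrite inE.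
- apply/seteqP; split=> [_ [x _ <-]|x Ax]; first exact: set_valP.
  have [z _ fz] := @surj _ _ _ _ f (exist _ x (mem_set Ax)) I.
  by exists z => //=; rewrite fz.
Qed.

(** * Subsets of graphs *)

Lemma closed_arc_piece (R : realType) (G : metricType R) (g : R -> G) (a b : R) :
  arc_param g -> 0 <= a -> b <= 1 -> closed (g @` [set t | a <= t <= b]).
Proof.
move=> [cg _] a0 b1; apply: compact_closed; first exact: metric_hausdorff.
have -> : [set t | a <= t <= b] = `[a, b]%classic.
  by apply/seteqP; split=> t /=; rewrite in_itv.
apply: continuous_compact; last exact: segment_compact.
apply: continuous_subspaceW cg => t /=; rewrite in_itv /unit_interval/= => /andP[at_ tb].
by rewrite (le_trans a0 at_) (le_trans tb b1).
Qed.

Section graph.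
Variables (R : realType) (G : metricType R) (n : nat) (g : 'I_n -> R -> G).
Hypotheses (gP : forall i, arc_param (g i))
  (g_cover : forall x, exists i, arc_image (g i) x)
  (g_meet : forall i j, i <> j ->
    arc_image (g i) `&` arc_image (g j) `<=` arc_ends (g i) `&` arc_ends (g j)).

Lemma arc_inj i s t : 0 <= s <= 1 -> 0 <= t <= 1 -> g i s = g i t -> s = t.
Proof. by move=> hs ht; apply: (gP i).2; rewrite inE. Qed.

Lemma meet_arc_end i j t : i <> j -> 0 <= t <= 1 -> arc_image (g j) (g i t) ->
  t = 0 \/ t = 1.
Proof.
move=> ij ht gj; have [|[] e _] := @g_meet i j ij (g i t).
- by split=> //; exists t.
- by left; apply: arc_inj e => //; lra.
- by right; apply: arc_inj e => //; lra.
Qed.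

(** Other arcs meet arc [i] only at its ends, so the complement is a finite union of closed arc
    pieces. *)
Lemma open_arc_piece i s u : 0 <= s -> u <= 1 ->
  open (g i @` [set t | s < t < u]).
Proof.
move=> s0 u1; rewrite -[X in open X]setCK; apply: closed_openC.
(* [Num.min s 1] and [Num.max u 0] keep the parameters in the unit interval when [s > 1] or
   [u < 0]. *)
have -> : ~` (g i @` [set t | s < t < u]) =
   (\bigcup_(j in [set j | j <> i]) g j @` [set t | 0 <= t <= 1]) `|`
   (g i @` [set t | 0 <= t <= Num.min s 1] `|`
    g i @` [set t | Num.max u 0 <= t <= 1]).
  apply/seteqP; split=> [x nx|x].
    have [j [t]] := g_cover x; rewrite /unit_interval/= => ht gt.
    have [ji|ji] := pselect (j = i); last by left; exists j => //; exists t.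
    rewrite -{}ji in nx *; right.
    have [ts|st] := leP t s; first by left; exists t => //=; rewrite le_min; lra.
    have [ut|tu] := leP u t; first by right; exists t => //=; rewrite ge_max; lra.
    by case: nx; exists t => //=; rewrite st.
  move=> h [t /= ht gt]; have t01 : 0 <= t <= 1 by lra.
  move: h; rewrite -gt => -[[j /= ji gj]|[[v hv e]|[v hv e]]].
  - by have [] := meet_arc_end (nesym ji) t01 gj; lra.
  - have v01 : 0 <= v <= 1 by move: hv => /=; rewrite le_min; lra.
    by move: hv; rewrite /= (arc_inj v01 t01 e) le_min; lra.
  - have v01 : 0 <= v <= 1 by move: hv => /=; rewrite ge_max; lra.
    by move: hv; rewrite /= (arc_inj v01 t01 e) ge_max; lra.
apply: closedU; last apply: closedU.
- by apply: closed_bigcup => [|j _]; [exact: finite_finset|exact: closed_arc_piece].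
- by apply: closed_arc_piece => //; rewrite ge_min lexx orbT.
- by apply: closed_arc_piece => //; rewrite le_max lexx orbT.
Qed.

Variable K : set G.
Hypothesis K_no_interior : forall O, open O -> O !=set0 -> ~ O `<=` K.

Lemma cut_point i s u : 0 <= s -> s < u -> u <= 1 ->
  exists2 t, s < t < u & ~ K (g i t).
Proof.
move=> s0 su u1; apply: contrapT => h.
apply: (K_no_interior (open_arc_piece i s0 u1)).
  by exists (g i ((s + u) / 2)); exists ((s + u) / 2) => //=; lra.
by move=> _ [t ht <-]; apply: contrapT => nK; apply: h; exists t.
Qed.

(** [P] and [Q] may overlap off [K]: closed pieces of an arc share the point at which it is cut. *)
Definition separated_in (x y : G) := exists P Q : set G,
  [/\ closed P, closed Q, K `<=` P `|` Q, K `&` (P `&` Q) = set0 & P x /\ Q y].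

Lemma separated_in_sym x y : separated_in x y -> separated_in y x.
Proof.
by move=> [P [Q [cP cQ KPQ PQ0 [Px Qy]]]]; exists Q, P; split; rewrite 1?setUC 1?(setIC Q).
Qed.

(** Cut the arc off [K] on both sides of [t], before reaching [y]. The closed subarc and the
    complement of the open one meet only in the two cut points. *)
Lemma separated_in_arc i t y : 0 < t < 1 -> y <> g i t -> separated_in (g i t) y.
Proof.
move=> ht ny.
have [a [b [a0 at_ tb b1 yab]]] : exists a b,
    [/\ 0 <= a, a < t, t < b, b <= 1 & forall v, a < v < b -> g i v <> y].
  have [[v hv gv]|nyi] := pselect (arc_image (g i) y); last first.
    exists 0, 1; split=> //; try lra.
    by move=> v hv gv; apply: nyi; exists v => //; rewrite /unit_interval/=; lra.
  rewrite /unit_interval/= in hv.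
  have [tv|vt|tv] := ltgtP t v; last by case: ny; rewrite -gv tv.
  - exists 0, v; split=> //; try lra.
    by move=> w hw; rewrite -gv => /arc_inj e; have := e ltac:(lra) ltac:(lra); lra.
  - exists v, 1; split=> //; try lra.
    by move=> w hw; rewrite -gv => /arc_inj e; have := e ltac:(lra) ltac:(lra); lra.
have [s hs Ks] := cut_point i a0 at_ (ltW (andP ht).2).
have [u hu Ku] := cut_point i (ltW (andP ht).1) tb b1.
exists (g i @` [set v | s <= v <= u]), (~` (g i @` [set v | s < v < u])); split.
- by apply: closed_arc_piece; [exact: gP|lra|lra].
- by apply: open_closedC; apply: open_arc_piece; lra.
- move=> z _; have [[v hv <-]|nz] := pselect ((g i @` [set v | s < v < u]) z).
    by left; exists v => //=; rewrite /= in hv; lra.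
  by right.
- apply/seteqP; split=> // z [Kz [[v /= hv gv] nz]].
  have [sv|vs] := ltP s v; last first.
    by apply: Ks; rewrite (_ : s = v) ?gv//; lra.
  have [vu|uv] := ltP v u; last first.
    by apply: Ku; rewrite (_ : u = v) ?gv//; lra.
  by apply: nz; exists v => //=; rewrite sv.
- split; first by exists t => //=; lra.
  by move=> [v /= hv]; apply: yab; lra.
Qed.

Let bit (c : bool) : R := if c then 1 else 0.

(* Cut every arc at a point off K; P is the star of half-arcs around x. *)
Lemma separated_in_vertices i j b c x : x = g i (bit b) ->
  x <> g j (bit c) -> separated_in x (g j (bit c)).
Proof.
move=> xE xy.
have /choice[s hs] : forall k, exists t, 0 < t < 1 /\ ~ K (g k t).
  move=> k; have [t ht Kt] := cut_point k (lexx 0) (@ltr01 R) (lexx 1).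
  by exists t.
pose half (kd : 'I_n * bool) : set G := if kd.2
  then g kd.1 @` [set t | s kd.1 <= t <= 1]
  else g kd.1 @` [set t | 0 <= t <= s kd.1].
have chalf kd : closed (half kd).
  case: kd => k d; have [sk _] := hs k.
  by rewrite /half; case: d => /=; apply: closed_arc_piece => //; lra.
have end_half k d : half (k, d) (g k (bit d)).
  have [sk _] := hs k.
  by case: d; rewrite /half/bit/=; [exists 1|exists 0] => //=; lra.
have bitE k d t : (if d then s k <= t <= 1 else 0 <= t <= s k) ->
    t = 0 \/ t = 1 -> t = bit d.
  by have [sk _] := hs k; rewrite /bit; case: d => ht [] t01; lra.
have half_end k l d z : k <> l -> half (k, d) z -> arc_image (g l) z ->
    z = g k (bit d).
  have [sk _] := hs k => kl hz lz.
  have [t ht gt] : exists2 t, (if d then s k <= t <= 1 else 0 <= t <= s k) & g k t = z.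
    by move: hz; rewrite /half; case: (d) => -[t ht gt]; exists t.
  have t01 : 0 <= t <= 1 by move: ht; case: (d); lra.
  rewrite -gt in lz *; congr (g k _).
  exact: bitE ht (meet_arc_end kl t01 lz).
have half_arc kd z : half kd z -> arc_image (g kd.1) z.
  case: kd => k d; have [sk _] := hs k.
  by rewrite /half /arc_image /unit_interval; case: d => -[t /= ht gt]; exists t => //=; lra.
exists (\bigcup_(kd in [set kd | g kd.1 (bit kd.2) = x]) half kd),
  (\bigcup_(kd in [set kd | g kd.1 (bit kd.2) <> x]) half kd); split.
- by apply: closed_bigcup => //; exact: finite_finset.
- by apply: closed_bigcup => //; exact: finite_finset.
- move=> z _; have [k [t]] := g_cover z; rewrite /unit_interval /= => ht gt.
  have [d hd] : exists d, half (k, d) z.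
    by have [ts|st] := leP t (s k); [exists false|exists true];
      rewrite /half; exists t => //=; lra.
  by have [e|e] := pselect (g k (bit d) = x); [left|right]; exists (k, d).
- apply/seteqP; split=> // z [Kz [[[k d] /= kx hz] [[l e] /= lx hz']]].
  (* Halves of different arcs can meet only at the vertex of each half, so [z] would be both a
     vertex equal to [x] and one different from [x]. The two halves of one arc share only the cut
     point, which is off [K]. *)
  have [kl|kl] := pselect (k = l); last first.
    apply: lx; rewrite -kx -(half_end k l d z kl hz); last exact: (half_arc (l, e)).
    rewrite (half_end l k e z (nesym kl) hz')//.
    exact: (half_arc (k, d)).
  have [sk Ks] := hs k; move: lx hz'; rewrite -{}kl => lx hz'.
  have de : d <> e by move=> de; apply: lx; rewrite -de.
  have [t [u [ht hu gt gu]]] : exists t u,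
      [/\ 0 <= t <= s k, s k <= u <= 1, g k t = z & g k u = z].
    move: hz hz' de; rewrite /half; case: d {kx}; case: e {lx} => //=.
      by move=> [u hu gu] [t ht gt] _; exists t, u.
    by move=> [u hu gu] [t ht gt] _; exists u, t.
  have tu : t = u by apply: (@arc_inj k); [lra|lra|rewrite gt gu].
  by apply: Ks; rewrite (_ : s k = t) ?gt//; lra.
- split; first by rewrite xE; exists (i, b) => //=; exact: end_half.
  by exists (j, c) => [/= e|]; [exact: xy|exact: end_half].
Qed.

Lemma graph_separated_in x y : x <> y -> separated_in x y.
Proof.
move=> xy; have endpoint z : (exists i t, 0 < t < 1 /\ z = g i t) \/
    exists i b, z = g i (bit b).
  have [i [t]] := g_cover z; rewrite /unit_interval /= => ht gt.
  have [t0|t0] := eqVneq t 0; first by right; exists i, false; rewrite -gt t0.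
  have [t1|t1] := eqVneq t 1; first by right; exists i, true; rewrite -gt t1.
  by left; exists i, t; split=> //; lra.
have [[i [t [ht xt]]]|[i [b xb]]] := endpoint x.
  by rewrite xt; apply: separated_in_arc => //; rewrite -xt; exact: nesym.
have [[j [t [ht yt]]]|[j [c yc]]] := endpoint y.
  apply: separated_in_sym.
  by rewrite yt; apply: separated_in_arc => //; rewrite -yt.
by rewrite yc; apply: separated_in_vertices xb _; rewrite -yc.
Qed.

End graph.

Lemma graph_cantor_subset (R : realType) (G : metricType R) (K : set G) :
  is_graph G -> closed K -> K !=set0 -> K `<=` limit_point K ->
  (forall O, open O -> O !=set0 -> ~ O `<=` K) -> cantor_set K.
Proof.
move=> [_ [cG [n [g [gP [gc gm]]]]]] cK K0 limK Kint.
apply: zero_dimensional_perfect_cantor => //; first exact: subclosed_compact cG _.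
move=> x y _ _ xy; exact: (graph_separated_in gP gc gm Kint xy).
Qed.

(** * Generic fibres of a graph bundle *)

Lemma open_setXT (S T : topologicalType) (U : set S) :
  open U -> open (U `*` [set: T]).
Proof.
move=> oU; rewrite (_ : _ `*` _ = fst @^-1` U).
  by apply: open_comp => // x _; exact: cvg_fst.
by apply/seteqP; split=> x // [].
Qed.

(** Through every point of [E] passes a continuous local section, obtained by holding the
    [G]-coordinate of a chart fixed. *)
Lemma bundle_projection_open (R : realType) (E B G : metricType R) (p : E -> B)
    (O : set E) :
  graph_bundle G p -> open O -> open (p @` O).
Proof.
move=> [_ [_ [_ [cp [_ triv]]]]] oO; rewrite openE => _ [x Ox <-].
have [U [oU [Ux [h [k [_ [ck [hU [kU [kh [hk h1]]]]]]]]]]] := triv (p x).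
pose s b := k (b, (h x).2).
have hx : h x = (p x, (h x).2) by rewrite -h1//; case: (h x).
have sx : s (p x) = x by rewrite /s -hx kh.
have cs : {for p x, continuous s}.
  have ck' : {for (p x, (h x).2), continuous k}.
    move: ck; rewrite continuous_open_subspace; last exact: open_setXT.
    by apply; rewrite inE.
  apply: (@continuous_comp _ _ _ (fun b => (b, (h x).2)) k) ck'.
  by apply: cvg_pair; [exact: cvg_id|exact: cvg_cst].
have : nbhs (p x) (U `&` s @^-1` O).
  apply: filterI; first exact: open_nbhs_nbhs.
  by apply: cs; rewrite sx; exact: open_nbhs_nbhs.
apply: filterS => b [Ub Osb]; exists (s b) => //.
have Ubg : (U `*` [set: G]) (b, (h x).2) by [].
by rewrite /s -(h1 _ (kU _ Ubg)) (hk _ Ubg).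
Qed.

(** [k] identifies [G] with the fibre over [b]. Continuity of [q] is stated in [E], at points of
    that fibre, so that neighbourhoods in [G] pull back to neighbourhoods in [E]. *)
Lemma bundle_fibre_chart (R : realType) (E B G : metricType R) (p : E -> B)
    (b : B) :
  graph_bundle G p -> exists (k : G -> E) (q : E -> G),
    [/\ continuous k, forall y, p (k y) = b, cancel k q,
        forall x, p x = b -> k (q x) = x &
        forall x, p x = b -> {for x, continuous q}].
Proof.
move=> [_ [_ [_ [cp [_ triv]]]]].
have [U [oU [Ub [h [k [ch [ck [hU [kU [kh [hk h1]]]]]]]]]]] := triv b.
have Ubg y : (U `*` [set: G]) (b, y) by [].
exists (fun y => k (b, y)), (fun x => (h x).2); split.
- move=> y; have ck' : {for (b, y), continuous k}.
    move: ck; rewrite continuous_open_subspace; last exact: open_setXT.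
    by apply; rewrite inE.
  apply: (@continuous_comp _ _ _ (fun y => (b, y)) k) ck'.
  by apply: cvg_pair; [exact: cvg_cst|exact: cvg_id].
- by move=> y; rewrite -(h1 _ (kU _ (Ubg y))) (hk _ (Ubg y)).
- by move=> y; rewrite (hk _ (Ubg y)).
- move=> x px; have Ux : (p @^-1` U) x by rewrite /= px.
  by rewrite -[X in (X, _)]px -h1// -surjective_pairing kh.
- move=> x px; have Ux : (p @^-1` U) x by rewrite /= px.
  have ch' : {for x, continuous h}.
    move: ch; rewrite continuous_open_subspace; first by apply; rewrite inE.
    by apply: open_comp => // z _; exact: cp.
  by apply: (continuous_comp ch'); exact: cvg_snd.
Qed.

(** Perfectness and empty interior are carried along the chart to [G]; the last hypothesis says that
    [M] has no interior relative to the fibre over [b]. *)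
Lemma fibre_cantor_set (R : realType) (E B G : metricType R) (p : E -> B)
    (M : set E) (b : B) :
  graph_bundle G p -> closed M -> fibre p M b !=set0 ->
  fibre p M b `<=` limit_point (fibre p M b) ->
  (forall O x, open O -> O x -> p x = b -> exists y, [/\ O y, p y = b & ~ M y]) ->
  cantor_set (fibre p M b).
Proof.
move=> bundle cM [x0 [Mx0 px0]] limM intM.
have [k [q [ck pk kK qK cq]]] := bundle_fibre_chart b bundle.
have -> : fibre p M b = k @` (k @^-1` M).
  apply/seteqP; split=> [x [Mx px]|_ [y My <-]]; last by split=> //; exact: pk.
  by exists (q x); rewrite /= qK.
apply: (cantor_set_image ck (can_inj kK)); apply: graph_cantor_subset.
- by case: bundle => _ [_ []].
- by apply: preimage_closed => // y _; exact: ck.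
- by exists (q x0); rewrite /= qK.
- move=> y My V yV; have kyV : nbhs (k y) (q @^-1` V).
    by apply: (cq _ (pk y)); rewrite kK.
  have [x [xy [Mx px] Vx]] := limM (k y) (conj My (pk y)) _ kyV.
  exists (q x); split=> //; last by rewrite /= qK.
  by apply: contra_neq xy => <-; rewrite qK.
- move=> O oO [y Oy] OM.
  have [|x [/interior_subset Ox px]] :=
      intM (interior (q @^-1` O)) (k y) (@open_interior _ _) _ (pk y).
    by apply: (cq _ (pk y)); rewrite kK; exact: open_nbhs_nbhs.
  by apply; rewrite -(qK x px); exact: OM.
Qed.

(** Suppose the bad [b] for one basic [C n] were dense in an open [U]. The part of the interior of
    [C n] over [U] is nonempty and, [M] being nowhere dense, contains a point off [M]; as [p] is
    open, no [b] near its projection is bad. *)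
Lemma meager_fibre_interior (R : realType) (E : metricType R)
    (B : topologicalType) (p : E -> B) (M : set E) :
  compact [set: E] -> continuous p -> (forall O, open O -> open (p @` O)) ->
  closed M -> nowhere_dense_set M ->
  meager [set b | exists O x, [/\ open O, O x, p x = b &
    forall y, O y -> p y = b -> M y]].
Proof.
move=> cE cp op cM ndM; have [C [cC baseC]] := compact_closed_base cE.
apply: (@meager_sub _ _ (\bigcup_n (p @` (C n)° `\` p @` ((C n)° `\` M)))).
  move=> b [W [x [oW Wx px WM]]].
  have [n [xC CW]] := baseC x W (open_nbhs_nbhs (conj oW Wx)).
  exists n => //; split; first by exists x.
  by move=> [y [/interior_subset Cy nMy] py]; apply: nMy; apply: WM => //; exact: CW.
apply: meager_bigcup => n; apply: nowhere_dense_meager; apply/nowhere_denseP.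
have oCM : open ((C n)° `\` M).
  by apply: openI; [exact: open_interior|exact: closed_openC].
move=> U oU [b Ub] UA; have [_ [[[x Cx <-] _] Upx]] :=
  UA b Ub U (open_nbhs_nbhs (conj oU Ub)).
have oW : open ((C n)° `&` p @^-1` U).
  by apply: openI; [exact: open_interior|apply: open_comp => // z _; exact: cp].
have [y [[Cy Uy] nMy]] : exists y, ((C n)° `&` p @^-1` U) y /\ ~ M y.
  apply: contrapT => h.
  move/(closed_nowhere_denseP cM) : ndM => /(_ _ oW); apply.
    by exists x.
  by move=> y Wy; apply: contrapT => nMy; apply: h; exists y.
have pyN : nbhs (p y) (p @` ((C n)° `\` M)).
  by apply: open_nbhs_nbhs; split; [exact: op|exists y].
by have [z [[_ nz] /nz]] := UA (p y) Uy _ pyN.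
Qed.

(** The points at which the set-valued map sending [b] to [fibre p M b] fails to be lower
    semicontinuous. *)
Definition discontinuity_fibres (E B : topologicalType) (p : E -> B) (M : set E) :=
  [set b | exists x V, [/\ M x, p x = b, nbhs x V & ~ nbhs b (p @` (M `&` V))]].

(** Shrinking the neighbourhood to some [C n] puts [b] in the closed set [D n] but not in its
    interior. *)
Lemma meager_fibre_discontinuity (R : realType) (E B : metricType R)
    (p : E -> B) (M : set E) :
  compact [set: E] -> continuous p -> closed M ->
  meager (discontinuity_fibres p M).
Proof.
move=> cE cp cM; have [C [cC baseC]] := compact_closed_base cE.
pose D n := p @` (M `&` C n).
apply: (@meager_sub _ _ (\bigcup_n (D n `\` (D n)°))).
  move=> b [x [V [Mx px /baseC[n [xC CV]] nbV]]]; exists n => //; split.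
    by exists x => //; split=> //; exact: nbhs_singleton.
  by move=> h; apply: nbV; apply: filterS h; apply: image_subset; exact: setIS.
apply: meager_bigcup => n; apply: nowhere_dense_meager.
apply: nowhere_dense_closed_setD_interior; apply: compact_closed_image => //.
  exact: metric_hausdorff.
by apply: closedI.
Qed.

(** * Counting points in fibres *)

(** A lower bound for the cardinality, usable before the set is known to be finite. *)
Definition has_points (T : Type) (n : nat) (A : set T) :=
  exists x : 'I_n -> T, injective x /\ forall i, A (x i).

Lemma has_points_le (T : Type) m n (A : set T) :
  (m <= n)%N -> has_points n A -> has_points m A.
Proof.
move=> mn [x [xi Ax]]; exists (x \o widen_ord mn); split=> [|i]; last exact: Ax.
by move=> i j /xi/(congr1 val)/= ij; apply: val_inj.
Qed.

Lemma has_points_image (S T : Type) n (F : S -> T) (A : set S) (B : set T) :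
  B `<=` F @` A -> has_points n B -> has_points n A.
Proof.
move=> BF [x [xi Bx]].
have /choice[y hy] : forall i, exists y, A y /\ F y = x i.
  by move=> i; have [y Ay Fy] := BF _ (Bx i); exists y.
exists y; split=> [i j yij|i]; last by case: (hy i).
by apply: xi; rewrite -(hy i).2 -(hy j).2 yij.
Qed.

Lemma has_points_card (T : Type) n (A : set T) :
  has_points n A -> ~ has_points n.+1 A -> (A #= `I_n)%card.
Proof.
move=> [x [xi Ax]] nA.
have -> : A = range x.
  apply/seteqP; split=> [a Aa|_ [i _ <-]]; last exact: Ax.
  apply: contrapT => na; apply: nA.
  (* The point [a] outside the range of [x] becomes the value at the last index. *)
  exists (fun i => if unlift ord_max i is Some j then x j else a); split.
    move=> i j; case: unliftP => [i' ->|->]; case: unliftP => [j' ->|->] // e.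
    - by rewrite (xi _ _ e).
    - by case: na; exists i'.
    - by case: na; exists j'.
  by move=> i; case: unliftP => [j _|_]; [exact: Ax|].
have xT : (range x #= [set: 'I_n])%card by apply: inj_card_eq => i j _ _; exact: xi.
by rewrite (card_eql xT) card_eq_sym card_II.
Qed.

(* Within a fibre with at most one point in V, the first hitting time of V
   followed by F^(K-k) determines F^K. *)
Lemma has_points_bounded (T : Type) (F : T -> T) (K : nat) (A V : set T) :
  (forall x, A x -> exists2 k, (k <= K)%N & V (iter k F x)) ->
  (forall k x y, (k <= K)%N -> A x -> A y -> V (iter k F x) -> V (iter k F y) ->
    iter k F x = iter k F y) ->
  ~ has_points K.+2 (iter K F @` A).
Proof.
move=> hit uniq [x [xi Fx]].
have /choice[y hy] : forall i, exists yk : T * 'I_K.+1,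
    [/\ A yk.1, iter K F yk.1 = x i & V (iter yk.2 F yk.1)].
  move=> i; have [y Ay Fy] := Fx i; have [k kK Vk] := hit y Ay.
  by exists (y, Ordinal (kK : (k < K.+1)%N)).
(* Hitting times run from [0] to [K], which is [K.+1] values; they cannot be distinct for [K.+2]
   points. *)
have inj : injective (fun i => (y i).2).
  move=> i j /= e; apply: xi; have [Ai <- Vi] := hy i; have [Aj <- Vj] := hy j.
  have kK : ((y i).2 <= K)%N by rewrite -ltnS.
  have split_iter z : iter K F z = iter (K - (y i).2) F (iter (y i).2 F z).
    by rewrite -iterD subnK.
  rewrite !split_iter; congr iter.
  by apply: uniq => //; rewrite e.
by have := leq_card _ inj; rewrite !card_ord ltnn.
Qed.

(** Lift [x] to some [y] in [M] with [F y = x]. Both [p y] and the previous point of the orbit of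
    [c] are preimages of [p x], so uniqueness puts [y] over that point, and induction applies. *)
Lemma fibre_iter_image (E B : Type) (p : E -> B) (F : E -> E) (f : B -> B)
    (M : set E) (c : B) k :
  F @` M = M -> (forall x, p (F x) = f (p x)) ->
  (forall i, (i < k)%N ->
    ~ exists d e, [/\ f d = iter i.+1 f c, f e = iter i.+1 f c & d <> e]) ->
  fibre p M (iter k f c) `<=` iter k F @` fibre p M c.
Proof.
move=> FM pF; elim: k => [|k IH] uniq x [Mx px]; first by exists x.
move: Mx px; rewrite -{1}FM => -[y My <-]; rewrite /= pF => py.
have [|z Mz zy] := IH (fun i ik => uniq i (ltnW ik)) y.
  split=> //=; apply: contrapT => ny; apply: (uniq k) => //.
  by exists (p y), (iter k f c).
by exists z => //=; rewrite zy.
Qed.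

(** Distinct points of the fibre get pairwise disjoint neighbourhoods, each still met by [M] over
    all base points near [b]. *)
Lemma has_points_near (E B : topologicalType) (p : E -> B) (M : set E) (b : B) n :
  hausdorff_space E ->
  (forall x V, M x -> p x = b -> nbhs x V -> nbhs b (p @` (M `&` V))) ->
  has_points n (fibre p M b) -> nbhs b [set c | has_points n (fibre p M c)].
Proof.
move=> hE open_at_b [x [xi Mx]].
have /choice[PQ hPQ] : forall ij : 'I_n * 'I_n, exists PQ : set E * set E,
    [/\ nbhs (x ij.1) PQ.1, nbhs (x ij.2) PQ.2 &
        ij.1 <> ij.2 -> PQ.1 `&` PQ.2 = set0].
  move=> [i j]; have [ij|ij] := pselect (i = j).
    by exists (setT, setT); split=> //; exact: filterT.
  have [|P [Q [xP xQ PQ0]]] := @hausdorff_separation E (x i) (x j) hE.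
    by move/xi.
  by exists (P, Q).
(* [x i] is the first member of the pair [(i, j)] and the second of [(j, i)]; both neighbourhoods
   enter so that [W i] and [W j] are disjoint. *)
pose W i := \bigcap_j ((PQ (i, j)).1 `&` (PQ (j, i)).2).
have xW i : nbhs (x i) (W i).
  have : \forall z \near x i, forall j, ((PQ (i, j)).1 `&` (PQ (j, i)).2) z.
    apply: filter_forall => j; apply: filterI.
      by case: (hPQ (i, j)).
    by case: (hPQ (j, i)).
  by apply: filterS => z hz j _; exact: hz.
have : \forall c \near b, forall i, (p @` (M `&` W i)) c.
  by apply: filter_forall => i; have [Mi pxi] := Mx i; exact: (open_at_b _ _ Mi pxi (xW i)).
apply: filterS => c hc.
have /choice[y hy] : forall i, exists y, (M `&` W i) y /\ p y = c.
  by move=> i; have [y MWy py] := hc i; exists y.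
exists y; split=> [i j yij|i]; last by have [[My _] py] := hy i.
apply: contrapT => ij; have [_ _ /(_ ij) /= e] := hPQ (i, j).
have [[_ Wi] pyi] := hy i; have [[_ Wj] pyj] := hy j.
have : ((PQ (i, j)).1 `&` (PQ (i, j)).2) (y i).
  by split; [case: (Wi j I)|rewrite yij; case: (Wj i I)].
by rewrite e.
Qed.

Section generic_fibres.
Variables (R : realType) (E B : metricType R) (p : E -> B) (M : set E).
Hypotheses (cE : compact [set: E]) (cp : continuous p) (cM : closed M).

(** Isolation is relative to the fibre: over these base points the fibre of [M] is not perfect. *)
Definition isolated_fibres :=
  [set b | ~ fibre p M b `<=` limit_point (fibre p M b)].

Lemma open_at_fibre b x V : ~ discontinuity_fibres p M b ->
  M x -> p x = b -> nbhs x V -> nbhs b (p @` (M `&` V)).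
Proof.
by move=> nb Mx px xV; apply: contrapT => h; apply: nb; exists x, V.
Qed.

(** Some basic set [C n] isolates a point in the fibres over a set [I n] dense in an open [U]. Two
    points of a generic fibre in [V] would spread, within disjoint neighbourhoods, to a fibre over
    [I n] and give two points there. *)
Lemma single_valued_open_set : ~ meager isolated_fibres ->
  exists V, [/\ open V, M `&` V !=set0 & forall b x y, ~ discontinuity_fibres p M b ->
    fibre p M b x -> fibre p M b y -> V x -> V y -> x = y].
Proof.
move=> nm; have [C [cC baseC]] := compact_closed_base cE.
pose I n := [set b | exists x, [/\ fibre p M b x, nbhs x (C n) &
  forall y, fibre p M b y -> C n y -> y = x]].
have [n nd] : exists n, ~ nowhere_dense_set (I n).
  apply: contrapT => /forallNP h; apply: nm; exists I; split.
    by move=> n; exact: contrapT.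
  move=> b /existsNP[x /not_implyP[Mbx]].
  rewrite not_limit_pointE => -[X xX MX].
  have [n [xC CX]] := baseC x X xX.
  by exists n => //; exists x; split=> // y Mby /CX Xy; exact: MX.
have [U [oU [b Ub] UI]] : exists U, [/\ open U, U !=set0 & U `<=` closure (I n)].
  apply: contrapT => h; apply: nd; apply/nowhere_denseP => U oU U0 UI.
  by apply: h; exists U.
pose V := interior (C n) `&` p @^-1` U.
have oV : open V.
  by apply: openI; [exact: open_interior|apply: open_comp => // z _; exact: cp].
exists V; split=> //.
  have [c [[x [[Mx px] xC _]] Uc]] := UI b Ub U (open_nbhs_nbhs (conj oU Ub)).
  by exists x; split=> //; split=> //; rewrite /= px.
move=> c x y nc [Mx px] [My py] Vx Vy; apply: contrapT => xy.
have [X [Y [xX yY XY0]]] := hausdorff_separation (@metric_hausdorff _ E) xy.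
have nX : nbhs c (p @` (M `&` (X `&` V))).
  apply: open_at_fibre nc Mx px _; apply: filterI => //.
  exact: open_nbhs_nbhs.
have nY : nbhs c (p @` (M `&` (Y `&` V))).
  apply: open_at_fibre nc My py _; apply: filterI => //.
  exact: open_nbhs_nbhs.
have Uc : U c by rewrite -px; exact: Vx.2.
have [d [[z [_ _ hz]] [[x' [Mx' [Xx' Vx']] px'] [y' [My' [Yy' Vy']] py']]]] :=
  UI c Uc _ (filterI nX nY).
have x'z : x' = z by apply: hz; [split|exact: interior_subset Vx'.1].
have y'z : y' = z by apply: hz; [split|exact: interior_subset Vy'.1].
have : (X `&` Y) z by split; [rewrite -x'z|rewrite -y'z].
by rewrite XY0.
Qed.

End generic_fibres.

(** * The dichotomy *)

Definition singular_base (E B : topologicalType) (p : E -> B) (f : B -> B)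
    (M : set E) : set B :=
  [set b | exists c d, [/\ f c = b, f d = b & c <> d]] `|` discontinuity_fibres p M.

(* Off this set every iterated preimage c of b is unique and p : M -> B is open
   at every point of M over c. *)
Definition backward_singular (E B : topologicalType) (p : E -> B) (f : B -> B)
    (M : set E) : set B :=
  \bigcup_k (iter k f @` singular_base p f M).

Section dichotomy.
Variables (R : realType) (E B G : metricType R) (p : E -> B).
Variables (F : E -> E) (f : B -> B) (M : set E).
Hypotheses (bundle : graph_bundle G p) (cF : continuous F) (pF : p \o F = f \o p)
  (minf : minimal_map f) (minM : minimal_set F M) (pM : p @` M = [set: B])
  (ndM : nowhere_dense_set M).

Let cE : compact [set: E]. Proof. by case: bundle. Qed.
Let cB : compact [set: B]. Proof. by case: bundle => _ []. Qed.
Let cp : continuous p. Proof. by case: bundle => _ [_ [_ []]]. Qed.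
Let cM : closed M. Proof. by case: minM. Qed.
Let hB : hausdorff_space B. Proof. exact: metric_hausdorff. Qed.
Let pF_app x : p (F x) = f (p x).
Proof. exact: (congr1 (fun h : E -> B => h x) pF). Qed.

Lemma fibre_nonempty b : fibre p M b !=set0.
Proof.
have [x Mx px] : (p @` M) b by rewrite pM.
by exists x.
Qed.

Lemma generic_cantor_fibre : meager (isolated_fibres p M) ->
  exists Rs : set B, residual Rs /\ forall b, Rs b -> cantor_set (fibre p M b).
Proof.
move=> mI; have popen O : open O -> open (p @` O) by exact: bundle_projection_open bundle.
have mJ := meager_fibre_interior cE cp popen cM ndM.
exists (~` (isolated_fibres p M `|` [set b | exists O x,
  [/\ open O, O x, p x = b & forall y, O y -> p y = b -> M y]])); split.
  by apply: residual_setC; exact: meagerU.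
move=> b; rewrite setCU => -[/contrapT limM nint].
apply: (fibre_cantor_set bundle cM (fibre_nonempty b) limM) => O x oO Ox px.
apply: contrapT => h; apply: nint; exists O, x; split=> // y Oy py.
by apply: contrapT => nMy; apply: h; exists y.
Qed.

Lemma meager_backward_singular : meager (backward_singular p f M).
Proof.
apply: meager_bigcup => k; apply: (minimal_map_iter_image_meager cB hB minf).
apply: meagerU; first exact: meager_noninjective_fibres.
exact: meager_fibre_discontinuity.
Qed.

Lemma backward_good_iter i k c : ~ backward_singular p f M (iter k f c) -> (i <= k)%N ->
  ~ singular_base p f M (iter i f c).
Proof.
move=> gk ik bi; apply: gk; exists (k - i)%N => //; exists (iter i f c) => //.
by rewrite -iterD subnK.
Qed.

Lemma generic_fibre_iter_image k c : ~ backward_singular p f M (iter k f c) ->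
  fibre p M (iter k f c) `<=` iter k F @` fibre p M c.
Proof.
move=> gk; apply: fibre_iter_image => // [|i ik h].
  by apply: minimal_set_image => //; exact: metric_hausdorff.
by apply: (backward_good_iter gk ik); left.
Qed.

Lemma generic_fibre_bounded : ~ meager (isolated_fibres p M) ->
  exists K, forall b, ~ backward_singular p f M b -> ~ has_points K (fibre p M b).
Proof.
move=> /(single_valued_open_set cE cp)[V [oV MV V1]].
have [K hK] := minimal_set_hits_bounded cE cF minM oV MV.
exists K.+2 => b gb.
(* Going back [K] steps covers the fibre over [b] by the image under [iter K F] of the fibre over
   [c], whose points all enter [V] by time [K]. *)
have [c fc] : exists c, iter K f c = b.
  elim: (K) (b) => [|k IH] d; first by exists d.
  have [d' fd'] := minimal_map_surj cB hB minf d; have [c hc] := IH d'.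
  by exists c; rewrite /= hc.
rewrite -{b}fc in gb *; move=> [x [xi Mx]].
apply: (@has_points_bounded _ F K (fibre p M c) V).
- by move=> y [My _]; exact: hK.
- have fibre_iter k y : fibre p M c y -> fibre p M (iter k f c) (iter k F y).
    move=> [My py]; split; first by apply: invariant_iter My; case: minM.
    by rewrite /= -py; elim: k => //= k <-; rewrite pF_app.
  move=> k y z kK Mcy Mcz; apply: (V1 (iter k f c)); [|exact: fibre_iter..].
  by move=> h; apply: (backward_good_iter gb kK); right.
- by exists x; split=> // i; exact: generic_fibre_iter_image gb _ (Mx i).
Qed.

Lemma generic_finite_fibre : ~ meager (isolated_fibres p M) ->
  exists (N : nat) (Rs : set B), (0 < N)%N /\ residual Rs /\
    forall b, Rs b -> (fibre p M b #= `I_N)%card.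
Proof.
move=> /generic_fibre_bounded[K hK].
have [[b1 gb1]|allbad] := pselect (exists b, ~ backward_singular p f M b); last first.
  (* If every base point is singular, [B] is meager and the empty set is residual, so the claim
     holds vacuously; no appeal to Baire's theorem is made. *)
  exists 1%N, set0; split=> //; split=> //.
  rewrite -setCT; apply: residual_setC; apply: meager_sub meager_backward_singular.
  by move=> b _; apply: contrapT => gb; apply: allbad; exists b.
pose P n := `[< exists b, ~ backward_singular p f M b /\ has_points n (fibre p M b) >].
have P1 : P 1%N.
  apply/asboolP; exists b1; split=> //; have [x Mx] := fibre_nonempty b1.
  by exists (fun=> x); split=> // i j _; rewrite !ord1.
have Ple n : P n -> (n <= K)%N.
  move=> /asboolP[b [gb Mb]]; rewrite leqNgt; apply/negP => Kn.
  exact: hK gb (has_points_le (ltnW Kn) Mb).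
have [N /asboolP[b0 [gb0 Mb0]] maxN] := ex_maxnP (ex_intro P _ P1) Ple.
(* The whole forward orbit of [b] is required to be good, since the time at which it enters the open
   set found below depends on [b]. *)
exists N, (~` (\bigcup_k (iter k f @^-1` backward_singular p f M))); split; first exact: maxN.
split.
  apply: residual_setC; apply: meager_bigcup => k.
  by apply: minimal_map_iter_preimage_meager => //; exact: meager_backward_singular.
move=> b gb.
have {}gb k : ~ backward_singular p f M (iter k f b) by move=> h; apply: gb; exists k.
have b0W : nbhs b0 [set c | has_points N (fibre p M c)].
  apply: has_points_near Mb0; first exact: metric_hausdorff.
  move=> x V; apply: open_at_fibre => h.
  by apply: (@backward_good_iter 0 0 b0) => //; right.
have [cf minfT] := minf.
(* The orbit of [b] reaches a point whose fibre has at least [N] points; these lift to the fibre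
   over [b], and maximality of [N] excludes one more. *)
have [|k /interior_subset Mkb] := @minimal_set_hits _ f _
    (interior [set c | has_points N (fibre p M c)]) b cf minfT (@open_interior _ _) _ I.
  by exists b0.
apply: has_points_card; first exact: has_points_image (generic_fibre_iter_image (gb k)) Mkb.
move=> MbN; suff : (N < N)%N by rewrite ltnn.
by apply: maxN; apply/asboolP; exists b; split=> //; exact: (gb 0%N).
Qed.

End dichotomy.

Theorem theoremE (R : realType) (E B G : metricType R) (p : E -> B)
  (F : E -> E) (f : B -> B) (M : set E) :
  graph_bundle G p ->
  continuous F -> continuous f -> p \o F = f \o p ->
  minimal_map f ->
  minimal_set F M -> p @` M = [set: B] ->
  nowhere_dense_set M ->
  (exists Rs : set B, residual Rs /\ forall b, Rs b -> cantor_set (fibre p M b)) \/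
  (exists (N : nat) (Rs : set B), (0 < N)%N /\ residual Rs /\
     forall b, Rs b -> (fibre p M b #= `I_N)%card).
Proof.
move=> bundle cF _ pF minf minM pM ndM.
have [mI|nmI] := pselect (meager (isolated_fibres p M)).
  by left; exact: generic_cantor_fibre bundle minM pM ndM mI.
by right; exact: generic_finite_fibre bundle cF pF minf minM pM nmI.
Qed.
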